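(* Two-memory stochastic strategies (i.e. strategies with two memory elements that may randomize both in the next-move function and in the memory update and initial memory distribution) are sufficient for $\mathsf{MDP}^{\{\mathbb{E},\mathrm{VaR},\mathrm{CVaR}\}}_{\mathsf{r},\mathsf{single}}$: for every MDP with absorbing target set and rational reward function, and every single-dimensional query with lower-bound constraints on expectation, VaR and CVaR of the weighted reachability reward, if some strategy satisfies the query then some two-memory stochastic strategy satisfies it.
   Context: An MDP $\mathcal{M}=(S,\mathsf{A},\mathsf{Av},\Delta,s_0)$ has finite state set $S$, finite action set $\mathsf{A}$, enabled actions $\mathsf{Av}(s)\neq\emptyset$ partitioning $\mathsf{A}$, transition function $\Delta:\mathsf{A}\to\mathcal{D}(S)$, initial state $s_0$. A strategy is $\sigma=(\sigma_u,\sigma_n,\alpha)$ over a countable memory set $\mathsf{M}$: $\sigma_u:\mathsf{A}\times S\times\mathsf{M}\to\mathcal{D}(\mathsf{M})$, $\sigma_n:S\times\mathsf{M}\to\mathcal{D}(\mathsf{A})$ supported on $\mathsf{Av}(s)$, $\alpha\in\mathcal{D}(\mathsf{M})$; it induces a measure $\mathbb{P}^\sigma$ on runs. Two-memory: $|\mathsf{M}|=2$. Weighted reachability: target set $T\subseteq S$ of absorbing states, $\mathbf{r}:T\to\mathbb{Q}$, $R^{\mathsf{r}}(\rho)$ is the reward of the first visited target state or $0$ if none. A query consists of $\mathsf{e},\mathsf{c},\mathsf{v}\in\mathbb{Q}\cup\{\bot\}$, $\mathsf{p},\mathsf{q}\in(0,1)$; $\sigma$ satisfies it iff $\mathbb{E}^\sigma[R^{\mathsf{r}}]\ge\mathsf{e}$,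 $\mathrm{CVaR}^\sigma_{\mathsf{p}}(R^{\mathsf{r}})\ge\mathsf{c}$, $\mathrm{VaR}^\sigma_{\mathsf{q}}(R^{\mathsf{r}})\ge\mathsf{v}$ ($\bot$ trivially satisfied). Here $\mathrm{VaR}_p(X)=\sup\{r\mid F_X(r)\le p\}$ and, with $v=\mathrm{VaR}_p(X)$, $\mathrm{CVaR}_p(X)=\frac1p\big(\int_{(-\infty,v)}x\,dF_X+(p-\mathbb{P}[X<v])v\big)$. *)

(* Defs.v *)
From HB Require Import structures.
From mathcomp Require Import all_boot all_order all_algebra.
From mathcomp Require Import all_classical all_reals all_analysis.

Set Implicit Arguments.
Unset Strict Implicit.
Unset Printing Implicit Defensive.

Import Order.TTheory GRing.Theory Num.Theory.
Import numFieldNormedType.Exports.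

Local Open Scope classical_set_scope.
Local Open Scope ring_scope.

Record distr (R : realType) (T : choiceType) := Distr {
  distr_fun :> T -> R;
  distr_ge0 : forall x, 0 <= distr_fun x;
  distr_sum1 : (\esum_(x in [set: T]) (distr_fun x)%:E = 1)%E }.

Lemma distr_inhabited (R : realType) (T : choiceType) (p : distr R T) :
  exists x : T, True.
Proof.
apply: contrapT => noT.
have /eqP := distr_sum1 p.
rewrite (_ : [set: T] = set0); last first.
  by rewrite -subset0 => x _; apply: noT; exists x.
by rewrite esum_set0 eq_sym onee_eq0.
Qed.

(* The enabled-action sets partition the actions: each action belongs to
   exactly one state. *)
Record mdp (R : realType) := Mdp {
  state : finType;
  action : finType;
  enabled : state -> {set action};
  enabled_neq0 : forall s, enabled s != finset.set0;
  enabled_disjoint : forall s s' a,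
    a \in enabled s -> a \in enabled s' -> s = s';
  enabled_cover : forall a, exists s, a \in enabled s;
  trans : action -> distr R state;
  init_state : state }.

Definition absorbing (R : realType) (D : mdp R) (s : state D) :=
  forall a, a \in enabled s -> trans a s = 1.

(* Since [countType] includes the finite types, so does [M]. *)
Record strategy (R : realType) (D : mdp R) (M : countType) := Strategy {
  update : action D -> state D -> M -> distr R M;
  next_move : state D -> M -> distr R (action D);
  next_enabled : forall s m a, a \notin enabled s -> next_move s m a = 0;
  init_mem : distr R M }.

Section Runs.
Variables (R : realType) (D : mdp R) (M : countType).

(* The states of the Markov chain that a strategy induces: current state,
   current memory element, and the action about to be played. *)
Definition config := (state D * M * action D)%type.

Definition init_prob (sigma : strategy D M) (x : config) : R :=
  let: (s, m, a) := x in
  (s == init_state D)%:R * init_mem sigma m * next_move sigma s m a.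

Definition step_prob (sigma : strategy D M) (x y : config) : R :=
  let: (s, m, a) := x in
  let: (s', m', a') := y in
  trans a s' * update sigma a s' m m' * next_move sigma s' m' a'.

Fixpoint path_prob (sigma : strategy D M) (x : config) (t : seq config) : R :=
  if t is y :: t' then step_prob sigma x y * path_prob sigma y t' else 1.

(* [sigma] is a parameter of the type only because measurable types are
   pointed, and the default run below takes its memory element from
   [init_mem sigma]. *)
Definition run (sigma : strategy D M) := nat -> config.

Variable sigma : strategy D M.

HB.instance Definition _ := Choice.copy (run sigma) (nat -> config).

Lemma run_inhabited : exists w : run sigma, True.
Proof.
have [m _] := distr_inhabited (init_mem sigma).
have [a _] := distr_inhabited (next_move sigma (init_state D) m).
by exists (fun=> (init_state D, m, a)).
Qed.

HB.instance Definition _ := isPointed.Build (run sigma)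
  (projT1 (cid run_inhabited)).

Definition cylinder (t : seq config) : set (run sigma) :=
  [set w | mkseq w (size t) = t].

Definition runs := g_sigma_algebraType (range cylinder).

(* A probability measure with these values on cylinders is unique, because the
   cylinders (together with the empty set) form a pi-system generating the
   sigma-algebra; it exists by the Ionescu-Tulcea theorem. *)
Definition run_measure (P : probability runs R) :=
  forall (x : config) (t : seq config),
    P (cylinder (x :: t)) = (init_prob sigma x * path_prob sigma x t)%:E.

Definition state_at (w : runs) (n : nat) : state D := (w n).1.1.

Variables (T : {set state D}) (r : state D -> rat).

(* Only the values of [r] on [T] matter. *)
Definition reward (w : runs) : R :=
  if pselect (exists n, state_at w n \in T) is left hit
  then ratr (r (state_at w (ex_minn hit))) else 0.

Lemma measurable_finite_horizon (n : nat) (E : set runs) :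
  (forall w w' : runs, (forall i, (i < n)%N -> w i = w' i) -> E w -> E w') ->
  measurable E.
Proof.
move=> En.
pose F k : set runs :=
  if unpickle k is Some t then
    if `[< exists2 w : runs, E w & t = mkseq w n >] then cylinder t else set0
  else set0.
rewrite (_ : E = \bigcup_k F k); last first.
  apply/seteqP; split=> [w Ew|w [k _]].
    exists (pickle (mkseq w n)) => //; rewrite /F pickleK.
    case: asboolP => [_|[]]; last by exists w.
    by rewrite /cylinder /= size_mkseq.
  rewrite /F; case: unpickle => // t; case: asboolP => // -[w' Ew' ->].
  rewrite /cylinder /= size_mkseq => ww'.
  apply: En Ew' => i ltin.
  by rewrite -(nth_mkseq (w i) w' ltin) -ww' nth_mkseq.
apply: bigcupT_measurable => k; rewrite /F.
case: unpickle => [t|]; last exact: measurable0.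
case: asboolP => _; last exact: measurable0.
by apply: sub_sigma_algebra; exists t.
Qed.

Lemma measurable_reward : measurable_fun [set: runs] reward.
Proof.
move=> _ Y _; rewrite setTI.
pose H n : set runs := [set w | [/\ state_at w n \in T,
  forall i, (i < n)%N -> state_at w i \notin T &
  Y (ratr (r (state_at w n)))]].
pose N n : set runs := [set w | state_at w n \in T].
pose C : set runs := [set w | Y 0].
rewrite (_ : reward @^-1` Y = \bigcup_n H n `|` (~` (\bigcup_n N n) `&` C)).
  apply: measurableU.
    apply: bigcupT_measurable => n; apply: (@measurable_finite_horizon n.+1).
    move=> w w' ww' [h1 h2 h3]; rewrite /H /state_at /= -ww'//.
    by split=> // i ltin; rewrite -ww' ?h2// ltnW.
  apply: measurableI.
    apply: measurableC; apply: bigcupT_measurable => n.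
    apply: (@measurable_finite_horizon n.+1) => w w' ww'.
    by rewrite /N /state_at /= ww'.
  exact: (@measurable_finite_horizon 0).
apply/seteqP; split=> w /=; rewrite /reward; case: pselect => hit.
- case: ex_minnP => n nT nmin Yn; left; exists n => //; split=> // i ltin.
  by apply/negP => /nmin; rewrite leqNgt ltin.
- by move=> Y0; right; split=> // -[n _ nT]; apply: hit; exists n.
- case=> [[n _ [nT nlt Yn]]|[noN _]].
    case: ex_minnP => k kT kmin; suff -> : k = n by [].
    apply/eqP; rewrite eqn_leq kmin//= leqNgt; apply/negP => /nlt.
    by rewrite kT.
  by case: noN; case: hit => n nT; exists n.
- case=> [[n _ [nT _ _]]|[_]//].
  by case: hit; exists n.
Qed.

HB.instance Definition _ :=
  isMeasurableFun.Build _ _ runs R reward measurable_reward.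

End Runs.

Section RiskMeasures.
Context {d : measure_display} {T : measurableType d} {R : realType}.
Variables (P : probability T R) (X : {RV P >-> R}) (p : R).

Definition VaR : R := sup [set r : R | (cdf X r <= p%:E)%E].

Definition CVaR : \bar R :=
  (p^-1%:E * (\int[distribution P X]_(x in `]-oo, VaR[) x%:E +
              (p%:E - distribution P X `]-oo, VaR[) * VaR%:E))%E.

End RiskMeasures.

(* [None] stands for the absent constraint. *)
Record query (R : realType) := Query {
  exp_bound : option rat;
  cvar_bound : option rat;
  var_bound : option rat;
  cvar_level : R;
  var_level : R;
  cvar_level_itv : 0 < cvar_level < 1;
  var_level_itv : 0 < var_level < 1 }.

Definition meets (R : realType) (b : option rat) (x : \bar R) : Prop :=
  if b is Some c then ((ratr c : R)%:E <= x)%E else True.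

Definition satisfies (R : realType) (D : mdp R) (M : countType)
    (sigma : strategy D M) (T : {set state D}) (r : state D -> rat)
    (q : query R) : Prop :=
  exists2 P : probability (runs sigma) R, run_measure P &
    let X : {RV P >-> R} := @reward R D M sigma T r in
    [/\ meets (exp_bound q) 'E_P[X],
        meets (cvar_bound q) (CVaR X (cvar_level q)) &
        meets (var_bound q) (VaR X (var_level q))%:E].

(* Main.v *)
(* Idea. The payoff depends only on the limits x_s of the probabilities that the
   target states s are occupied at time n, so it suffices to reproduce x with
   two memory elements.

   Truncating the given strategy at time N and counting actions gives a
   nonnegative flow y, together with the mass z still in play at time N, that
   satisfies the linear balance equations of the MDP up to an error tending to
   0. The flows y themselves may diverge, but cones generated by finitely many
   vectors are closed (Farkas), so an exact finite solution (y, z) with target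
   values x exists. Here z is supported on the set C of non-target states that are
   occupied infinitely often in expectation; from C one can avoid T forever,
   since infinite expected mass cannot leak from C to targets or to rarely
   visited states.

   The two-memory strategy commits on arrival in s, with probability
   z_s / (z_s + y_s), to staying in C forever, and otherwise plays the actions
   proportionally to y. Its uncommitted flow is at most y, so it reaches each s in
   T with probability at most x_s, and it commits with probability at most the
   sum of z; both sides add up to 1, hence all these are equalities. *)

Require Import Defs.
From HB Require Import structures.
From mathcomp Require Import all_boot all_order all_algebra.
From mathcomp Require Import all_classical all_reals all_analysis.
From mathcomp Require Import measurable_realfun.
From mathcomp Require Import ring lra.

Set Implicit Arguments.
Unset Strict Implicit.
Unset Printing Implicit Defensive.

Import Order.TTheory GRing.Theory Num.Theory.
Import numFieldNormedType.Exports.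

Local Open Scope classical_set_scope.
Local Open Scope ring_scope.

(** * Farkas' lemma and flows in an MDP *)

(** Induction on the list of generators. A functional separating [b] from the cone of the tail
    either is nonnegative on the head too, or allows projecting along the head and using the
    induction hypothesis again; [uniq s] lets the coefficients be a function on [J]. *)
Lemma farkas (R : realFieldType) (I : finType) (J : eqType) (s : seq J)
    (v : J -> I -> R) (b : I -> R) : uniq s ->
  (exists2 c : J -> R, (forall j, 0 <= c j) &
     forall i, b i = \sum_(j <- s) c j * v j i) \/
  (exists2 h : I -> R, (forall j, j \in s -> 0 <= \sum_i h i * v j i) &
     \sum_i h i * b i < 0).
Proof.
have dotB h w k u : \sum_i h i * (w i - k * u i) =
    (\sum_i h i * w i) - k * \sum_i h i * u i :> R.
  by rewrite mulr_sumr -sumrB; apply: eq_bigr => i _; ring.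
have dotBl h w k u : \sum_i (h i - k * w i) * u i =
    (\sum_i h i * u i) - k * \sum_i w i * u i :> R.
  by rewrite mulr_sumr -sumrB; apply: eq_bigr => i _; ring.
elim: s v b => [|j0 s IH] v b /=.
  move=> _; have [b0|/existsNP[i bi]] := pselect (forall i, b i = 0).
    by left; exists (fun=> 0) => // i; rewrite big_nil b0.
  right; exists (fun i => - b i); first by [].
  have : 0 < \sum_i b i ^+ 2.
    rewrite (bigD1 i)//= ltr_pwDl//; last by apply: sumr_ge0 => *; exact: sqr_ge0.
    by rewrite exprn_even_gt0//=; apply/eqP.
  rewrite -oppr_lt0 -sumrN => b2; rewrite (eq_bigr (fun i => - b i ^+ 2))//.
  by move=> i' _; rewrite mulNr.
move=> /andP[j0s us].
have [[c c0 cb]|[h hs hb]] := IH v b us.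
  left; exists (fun j => if j == j0 then 0 else c j) => [j|i].
    by case: ifP.
  rewrite big_cons eqxx mul0r add0r cb; apply: eq_big_seq => j js.
  by case: (j =P j0) js j0s => [-> ->|].
set dot := fun (h w : I -> R) => \sum_i h i * w i.
have [hj0|hj0] := leP 0 (dot h (v j0)).
  by right; exists h => // j; rewrite inE => /predU1P[->//|]; exact: hs.
(* Eliminate v j0 by projecting along it onto the kernel of h. *)
pose k (w : I -> R) := dot h w / dot h (v j0).
have kj j : j \in s -> k (v j) <= 0.
  by move=> js; rewrite /k mulr_ge0_le0 ?hs// invr_le0 ltW.
have kb : 0 < k b by rewrite /k nmulr_rgt0 ?invr_lt0.
have [[c c0 cb]|[h' h's h'b]] :=
    IH (fun j i => v j i - k (v j) * v j0 i) (fun i => b i - k b * v j0 i) us.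
  (* The coefficient of [v j0] undoes the projection; it is nonnegative because [k b > 0] and
     [k (v j) <= 0] on the tail. *)
  left; exists (fun j => if j == j0 then k b - \sum_(j <- s) c j * k (v j)
                         else c j) => [j|i].
    case: ifP => // _; rewrite subr_ge0 (le_trans _ (ltW kb))//.
    by rewrite big_seq sumr_le0// => j' j's; rewrite mulr_ge0_le0 ?kj.
  rewrite big_cons eqxx.
  set K := k b - _; have -> : \sum_(j <- s) (if j == j0 then K else c j) * v j i =
      \sum_(j <- s) c j * v j i.
    by apply: eq_big_seq => j js; case: (j =P j0) js j0s => [-> ->|].
  rewrite /K.
  have -> : b i = (b i - k b * v j0 i) + k b * v j0 i by ring.
  rewrite cb mulrBl mulr_suml.
  have -> : \sum_(j <- s) c j * v j i =
      \sum_(j <- s) c j * (v j i - k (v j) * v j0 i) +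
      \sum_(j <- s) c j * k (v j) * v j0 i.
    by rewrite -big_split/=; apply: eq_bigr => j _; ring.
  ring.
(* Subtracting [l] times [h] amounts to composing [h'] with the projection, so the new functional
   vanishes at [v j0]. *)
pose l := dot h' (v j0) / dot h (v j0).
have key w : dot (fun i => h' i - l * h i) w =
    dot h' (fun i => w i - k w * v j0 i).
  rewrite /dot dotB dotBl -!/(dot _ _) /l /k; ring.
right; exists (fun i => h' i - l * h i).
  move=> j; rewrite inE => /predU1P[->|js]; rewrite -/(dot _ _) key.
    by rewrite /dot dotB -!/(dot _ _) /k divff ?lt_eqF// mul1r subrr.
  exact: h's.
by rewrite -/(dot _ _) key.
Qed.

(** The coefficients may diverge, so compactness does not apply to them. Instead, a functional that
    is nonnegative on the generators is nonnegative on all approximants, hence at [b], which rules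
    out the separating case of [farkas]. *)
Lemma cone_closed (R : realType) (I J : finType) (v : J -> I -> R)
    (c : nat -> J -> R) (b : I -> R) :
  (forall n j, 0 <= c n j) ->
  (forall i, (\sum_j c n j * v j i) @[n --> \oo] --> b i) ->
  exists2 d : J -> R, (forall j, 0 <= d j) &
    forall i, b i = \sum_j d j * v j i.
Proof.
move=> c0 cb.
have [[d d0 db]|[h hv hb]] := farkas v b (index_enum_uniq J).
  by exists d.
have hcb : (\sum_i h i * \sum_j c n j * v j i) @[n --> \oo] -->
    \sum_i h i * b i.
  by apply: cvg_big => [|i _]; [exact: add_continuous|exact: cvgMl_tmp].
suff : 0 <= \sum_i h i * b i by rewrite leNgt hb.
apply: (cvgr_to_ge hcb); apply: nearW => n.
rewrite (_ : \sum_i _ = \sum_j c n j * \sum_i h i * v j i).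
  by apply: sumr_ge0 => j _; rewrite mulr_ge0// hv// mem_index_enum.
under eq_bigr do rewrite mulr_sumr.
rewrite exchange_big/=; apply: eq_bigr => j _; rewrite mulr_sumr.
by apply: eq_bigr => i _; rewrite mulrCA.
Qed.

Lemma bounded_series_cvg0 (R : realType) (f : nat -> R) (B : R) :
  (forall n, 0 <= f n) -> (forall N, \sum_(n < N) f n <= B) ->
  f @ \oo --> 0.
Proof.
move=> f0 fB; apply: cvg_series_cvg_0; apply: nondecreasing_is_cvgn.
  by apply: nondecreasing_series => n _ _; exact: f0.
by exists B => _ [N _ <-]; rewrite /series/= big_mkord.
Qed.

Lemma esum_finType (R : realType) (F : finType) (f : F -> R) :
  (forall x, 0 <= f x) ->
  (\esum_(x in [set: F]) (f x)%:E = (\sum_x f x)%:E)%E.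
Proof.
move=> f0; rewrite esum_fset; [|exact: finite_finset|by move=> x _; rewrite lee_fin].
rewrite -sumEFin -set_true; apply/esym/bigfs; first exact: index_enum_uniq.
by move=> x _; rewrite mem_index_enum.
Qed.

Section Flow.
Variables (R : realType) (D : mdp R).
Implicit Types (a b : action D) (s : state D).

Lemma trans_sum a : \sum_s trans a s = 1.
Proof.
by apply: EFin_inj; rewrite -(distr_sum1 (trans a)) esum_finType// => s; exact: distr_ge0.
Qed.

(** The enabled sets partition the actions, so an action determines its state and flows can be
    indexed by actions alone. *)
Definition src a : state D := projT1 (cid (enabled_cover a)).

Lemma enabled_src a s : (a \in enabled s) = (src a == s).
Proof.
rewrite /src; case: cid => s0 /= s0a; apply/idP/eqP => [sa|<-//].
exact: enabled_disjoint s0a sa.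
Qed.

Lemma absorbing_trans a s : absorbing (src a) -> trans a s = (src a == s)%:R.
Proof.
move=> /(_ a); rewrite enabled_src eqxx => /(_ isT) h.
have := trans_sum a; rewrite (bigD1 (src a))//= h.
rewrite -[in RHS](addr0 1) => /addrI /psumr_eq0P z.
case: eqP => [<-//|/eqP ne]; apply: z; last by rewrite eq_sym.
by move=> *; exact: distr_ge0.
Qed.

Definition occ (f : action D -> R) s : R := \sum_(a | src a == s) f a.

(** What the actions, used with intensities [f], send into [s] in one step. *)
Definition outflow (f : action D -> R) s : R := \sum_a f a * trans a s.

Lemma sum_occ f : \sum_s occ f s = \sum_a f a.
Proof. by rewrite /occ [RHS](partition_big src predT). Qed.

Lemma sum_outflow f : \sum_s outflow f s = \sum_a f a.
Proof.
by rewrite exchange_big/=; apply: eq_bigr => a _; rewrite -mulr_sumr trans_sum mulr1.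
Qed.

Lemma occ_ge0 f s : (forall a, 0 <= f a) -> 0 <= occ f s.
Proof. by move=> f0; exact: sumr_ge0. Qed.

(** With [u n a] the probability of playing [a] at time [n], these laws do not mention memory, so
    strategies with different memories become comparable. *)
Record action_flow (u : nat -> action D -> R) : Prop := ActionFlow {
  flow_ge0 : forall n a, 0 <= u n a;
  flow0 : forall s, occ (u 0%N) s = (s == init_state D)%:R;
  flowS : forall n s, occ (u n.+1) s = outflow (u n) s }.

Variable T : {set state D}.
Hypothesis T_absorbing : forall s, s \in T -> absorbing s.

Section FromFlow.
Variable u : nat -> action D -> R.
Hypothesis uflow : action_flow u.

Lemma flow_mass n : \sum_s occ (u n) s = 1.
Proof.
elim: n => [|n IH].
  under eq_bigr do rewrite (flow0 uflow).
  by rewrite (bigD1 (init_state D))//= eqxx big1 ?addr0// => s /negbTE->.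
by under eq_bigr do rewrite (flowS uflow); rewrite sum_outflow -sum_occ.
Qed.

Lemma flow_occ_ge0 n s : 0 <= occ (u n) s.
Proof. by apply: occ_ge0; exact: flow_ge0. Qed.

Lemma flow_occ_le1 n s : occ (u n) s <= 1.
Proof.
rewrite -(flow_mass n) (bigD1 s)//= lerDl.
by apply: sumr_ge0 => *; exact: flow_occ_ge0.
Qed.

Lemma outflow_target (f : action D -> R) s : s \in T ->
  outflow f s = occ f s + \sum_(a | src a != s) f a * trans a s.
Proof.
move=> sT; rewrite /outflow (bigID (fun a => src a == s))/=; congr (_ + _).
apply: eq_bigr => a /eqP as_; rewrite absorbing_trans as_ ?eqxx ?mulr1//.
exact: T_absorbing.
Qed.

Lemma flow_target_nd s : s \in T -> nondecreasing_seq (fun n => occ (u n) s).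
Proof.
move=> sT; apply/nondecreasing_seqP => n; rewrite (flowS uflow) outflow_target//.
rewrite lerDl; apply: sumr_ge0 => a _.
by rewrite mulr_ge0 ?distr_ge0 ?(flow_ge0 uflow).
Qed.

Lemma flow_target_cvg s : s \in T -> cvgn (fun n => occ (u n) s).
Proof.
move=> sT; apply: nondecreasing_is_cvgn; first exact: flow_target_nd.
by exists 1 => _ [n _ <-]; exact: flow_occ_le1.
Qed.

(** Expected action counts before time [N] are balanced up to the mass found in [s] at time [N],
    because the one-step changes of [occ (u n) s] telescope. *)
Lemma flow_telescope N s :
  \sum_a (\sum_(n < N) u n a) * (trans a s - (src a == s)%:R) =
  occ (u N) s - (s == init_state D)%:R.
Proof.
elim: N => [|N IH].
  rewrite (flow0 uflow) subrr big1// => a _; by rewrite big_ord0 mul0r.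
under eq_bigr do rewrite big_ord_recr/= mulrDl.
rewrite big_split/= IH (flowS uflow).
under [X in _ + X]eq_bigr do rewrite mulrBr.
rewrite sumrB -/(outflow _ _).
have -> : \sum_a u N a * (src a == s)%:R = occ (u N) s.
  rewrite /occ [RHS]big_mkcond/=; apply: eq_bigr => a _.
  by case: eqP; rewrite ?mulr1 ?mulr0.
ring.
Qed.

(** The expected number of visits to [s] is finite. *)
Definition rarely s := exists B, forall N, \sum_(n < N) occ (u n) s <= B.

Lemma often_action s : ~ rarely s -> exists2 a, src a = s &
  ~ exists B, forall N, \sum_(n < N) u n a <= B.
Proof.
move=> nr; apply: contrapT => h; apply: nr.
have [B HB] : exists B : action D -> R, forall a, src a = s ->
    forall N, \sum_(n < N) u n a <= B a.
  suff : forall a, exists B, src a = s -> forall N, \sum_(n < N) u n a <= B.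
    by move=> /boolp.choice[B HB]; exists B.
  move=> a; have [as_|] := pselect (src a = s); last by exists 0.
  have [[B HB]|nB] := pselect (exists B, forall N, \sum_(n < N) u n a <= B).
    by exists B.
  by exfalso; apply: h; exists a.
exists (\sum_(a | src a == s) B a) => N; rewrite exchange_big/=.
by apply: ler_sum => a /eqP as_; exact: (HB a as_ N).
Qed.

(** Some action at [s] is played infinitely often in expectation, and a fixed fraction of this goes
    to each successor [s']. A rarely visited [s'] could not receive it, nor could a target, which
    would accumulate more than mass 1. *)
Lemma often_stay s : s \notin T -> ~ rarely s ->
  exists2 a, src a = s &
    forall s', trans a s' != 0 -> s' \notin T /\ ~ rarely s'.
Proof.
move=> sT /often_action[a as_ na]; exists a => // s' as'.
have t0 : 0 < trans a s' by rewrite lt_neqAle eq_sym as' distr_ge0.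
have bnd N B : \sum_(n < N) u n a * trans a s' <= B ->
    \sum_(n < N) u n a <= B / trans a s'.
  by rewrite -mulr_suml ler_pdivlMr.
split.
  apply/negP => s'T; apply: na; exists (1 / trans a s') => N; apply: bnd.
  apply: le_trans (flow_occ_le1 N s').
  elim: N => [|N IH]; first by rewrite big_ord0 flow_occ_ge0.
  rewrite big_ord_recr/= (flowS uflow) outflow_target// lerD//.
  rewrite (bigD1 a)/=; last by apply: contraNneq sT => e; rewrite -as_ e.
  rewrite lerDl; apply: sumr_ge0 => b _.
  by rewrite mulr_ge0 ?distr_ge0 ?(flow_ge0 uflow).
move=> [B HB]; apply: na; exists (B / trans a s') => N; apply: bnd.
(* Moves made at time [n] are visits at time [n + 1], hence the bound at [N.+1]. *)
apply: le_trans (HB N.+1); rewrite big_ord_recl/= -[leLHS]add0r.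
rewrite lerD ?flow_occ_ge0//; apply: ler_sum => n _; rewrite /bump/= add1n.
rewrite (flowS uflow) /outflow (bigD1 a)//= lerDl; apply: sumr_ge0 => b _.
by rewrite mulr_ge0 ?distr_ge0 ?(flow_ge0 uflow).
Qed.

Lemma rarely_cvg0 s : rarely s -> occ (u n) s @[n --> \oo] --> 0.
Proof.
by move=> [B HB]; apply: bounded_series_cvg0 HB => n; exact: flow_occ_ge0.
Qed.

Lemma stationary_flow (x : state D -> R) :
  (forall s, s \in T -> occ (u n) s @[n --> \oo] --> x s) ->
  exists (C : {set state D}) (y : action D -> R) (z : state D -> R),
  [/\ [/\ forall a, 0 <= y a & forall s, 0 <= z s],
      (forall s, s \in C -> s \notin T),
      (forall s, s \in C -> exists2 a, src a = s &
         forall s', trans a s' != 0 -> s' \in C),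
      (forall s, s \notin C -> z s = 0) /\ (forall a, src a \in T -> y a = 0) &
      forall s, outflow y s + (s == init_state D)%:R =
                occ y s + z s + (if s \in T then x s else 0)].
Proof.
move=> ux.
pose C := [set s | (s \notin T) && `[< ~ rarely s >]]%SET.
(* Generators: an action contributes its net inflow, a state of [C] removes the mass that remains in
   it, and other states give the zero vector. *)
pose v (j : action D + state D) s : R :=
  match j with
  | inl a => trans a s - (src a == s)%:R
  | inr s' => if s' \in C then - (s == s')%:R else 0
  end.
pose c N (j : action D + state D) : R :=
  match j with inl a => \sum_(n < N) u n a | inr s => occ (u N) s end.
pose b s : R := (if s \in T then x s else 0) - (s == init_state D)%:R.
have sumJ (d : action D + state D -> R) s : \sum_j d j * v j s =
    \sum_a d (inl a) * (trans a s - (src a == s)%:R) -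
    (if s \in C then d (inr s) else 0).
  rewrite big_sumType/=; congr (_ + _); case: ifP => sC.
    rewrite (bigD1 s)//= sC eqxx mulrN1 big1 ?addr0// => s' s's.
    by case: ifP => _; rewrite 1?(eq_sym s) ?(negbTE s's) ?oppr0 mulr0.
  rewrite oppr0 big1// => s' _; case: ifP => // s'C; rewrite ?mulr0//.
  by case: eqP s'C => [<-|_ _]; rewrite ?sC// oppr0 mulr0.
have [||d d0 db] := @cone_closed R _ _ v c b.
- move=> N [a|s] /=; last exact: flow_occ_ge0.
  by apply: sumr_ge0 => *; exact: flow_ge0.
- move=> s; under eq_fun do rewrite sumJ flow_telescope.
  rewrite /b.
  (* The mass at time [N] tends to [x s] on [T], is removed exactly by the generators of [C] on [C],
     and tends to 0 at the remaining states, which are rarely visited. *)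
  have [sT|sT] := boolP (s \in T).
    have -> : s \in C = false by rewrite inE sT.
    under eq_fun do rewrite subr0.
    by apply: cvgB; [exact: ux|exact: cvg_cst].
  have [sC|sC] := boolP (s \in C).
    rewrite (_ : (fun n => _) = cst (0 - (s == init_state D)%:R)).
      exact: cvg_cst.
    by apply/funext => N /=; ring.
  under eq_fun do rewrite subr0.
  apply: cvgB; last exact: cvg_cst.
  apply: rarely_cvg0; apply: contrapT => nr; move: sC; rewrite inE sT/=.
  by move=> /negP; apply; apply/asboolP.
(* Targets are absorbing, so the generator of an action at a target is zero and its coefficient may
   be reset to 0. *)
exists C, (fun a => if src a \in T then 0 else d (inl a)),
  (fun s => if s \in C then d (inr s) else 0).
split.
- by split => [a|s]; case: ifP.
- by move=> s; rewrite inE => /andP[].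
- move=> s; rewrite inE => /andP[sT /asboolP sr].
  have [a as_ h] := often_stay sT sr; exists a => // s' /h[? ?].
  by rewrite inE; apply/andP; split => //; exact/asboolP.
- by split => [s /negbTE->|a ->].
- move=> s; have := db s; rewrite sumJ /b.
  move=> /eqP; rewrite subr_eq => /eqP e; rewrite e.
  rewrite (_ : \sum_a _ = outflow (fun a => if src a \in T then 0 else d (inl a)) s -
      occ (fun a => if src a \in T then 0 else d (inl a)) s); first ring.
  rewrite /outflow /occ [X in _ - X]big_mkcond/= -sumrB; apply: eq_bigr => a _.
  case: ifPn => aT; last by case: eqP => _ /=; ring.
  by rewrite absorbing_trans ?subrr; [case: eqP => _; ring|exact: T_absorbing].
Qed.

End FromFlow.
End Flow.

(** * Following a flow with two modes *)

Section TwoModes.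
Variables (R : realType) (D : mdp R) (T C : {set state D}).
Implicit Types (a b : action D) (s : state D).
Hypothesis T_absorbing : forall s, s \in T -> absorbing s.
Hypothesis CT : forall s, s \in C -> s \notin T.
Variables (stay : state D -> action D) (y : action D -> R) (x z : state D -> R).
Hypothesis src_stay : forall s, src (stay s) = s.
Hypothesis stayC :
  forall s, s \in C -> forall s', trans (stay s) s' != 0 -> s' \in C.
Hypothesis y_ge0 : forall a, 0 <= y a.
Hypothesis z_ge0 : forall s, 0 <= z s.
Hypothesis zC : forall s, s \notin C -> z s = 0.
Hypothesis yT : forall a, src a \in T -> y a = 0.
Hypothesis balance : forall s, outflow y s + (s == init_state D)%:R =
  occ y s + z s + (if s \in T then x s else 0).

Definition switch_prob s : R := z s / (z s + occ y s).

Definition stay_prob a : R := (a == stay (src a))%:R.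

(** Where [y] does not pass, a distribution is still required; the action [stay] supplies it. *)
Definition play_prob a : R :=
  if occ y (src a) == 0 then stay_prob a else y a / occ y (src a).

Lemma occ_stay_prob s : occ stay_prob s = 1.
Proof.
rewrite /occ (bigD1 (stay s)) /stay_prob/= ?src_stay ?eqxx//.
by rewrite big1 ?addr0// => a /andP[/eqP-> /negbTE->].
Qed.

Lemma occ_play_prob s : occ play_prob s = 1.
Proof.
have [s0|s0] := eqVneq (occ y s) 0.
  rewrite -(occ_stay_prob s); apply: eq_bigr => a /eqP as_.
  by rewrite /play_prob as_ s0 eqxx.
rewrite -[RHS](divff s0) /occ mulr_suml; apply: eq_bigr => a /eqP as_.
by rewrite /play_prob as_ (negbTE s0).
Qed.

Lemma stay_prob_ge0 a : 0 <= stay_prob a.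
Proof. exact: ler0n. Qed.

Lemma play_prob_ge0 a : 0 <= play_prob a.
Proof.
rewrite /play_prob; case: ifP => _; first exact: stay_prob_ge0.
by rewrite divr_ge0 ?occ_ge0.
Qed.

Lemma switch_prob_ge0 s : 0 <= switch_prob s.
Proof. by rewrite divr_ge0 ?addr_ge0 ?occ_ge0. Qed.

Lemma switch_prob_le1 s : switch_prob s <= 1.
Proof.
have [g0|g0] := eqVneq (z s + occ y s) 0.
  by rewrite /switch_prob g0 invr0 mulr0.
rewrite ler_pdivrMr ?mul1r ?lerDl ?occ_ge0//.
by rewrite lt_neqAle eq_sym g0 addr_ge0 ?occ_ge0.
Qed.

Lemma switch_probE s : switch_prob s * (occ y s + z s) = z s.
Proof.
rewrite [_ + z s]addrC.
have [g0|g0] := eqVneq (z s + occ y s) 0; last by rewrite divfK.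
rewrite g0 mulr0; apply/esym/eqP.
by move/eqP: g0; rewrite paddr_eq0 ?occ_ge0// => /andP[].
Qed.

Lemma switch_probC s : s \notin C -> switch_prob s = 0.
Proof. by move=> sC; rewrite /switch_prob zC// mul0r. Qed.

Lemma play_probE a : occ y (src a) * play_prob a = y a.
Proof.
rewrite /play_prob; case: eqP => [s0|/eqP s0]; last by rewrite mulrC divfK.
rewrite s0 mul0r; apply/esym; move: s0; rewrite /occ => /psumr_eq0P.
by apply => // *; exact: y_ge0.
Qed.

(** [v n a] and [w n a] stand for the probabilities of playing [a] at time [n] while uncommitted and
    while committed. *)
Variables v w : nat -> action D -> R.
Hypothesis v_ge0 : forall n a, 0 <= v n a.
Hypothesis w_ge0 : forall n a, 0 <= w n a.
Hypothesis v0 : forall a, v 0%N a =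
  (src a == init_state D)%:R * (1 - switch_prob (src a)) * play_prob a.
Hypothesis vS : forall n a, v n.+1 a =
  outflow (v n) (src a) * (1 - switch_prob (src a)) * play_prob a.
Hypothesis w0 : forall a, w 0%N a =
  (src a == init_state D)%:R * switch_prob (src a) * stay_prob a.
Hypothesis wS : forall n a, w n.+1 a =
  (outflow (v n) (src a) * switch_prob (src a) + outflow (w n) (src a)) *
  stay_prob a.

Let V N a : R := \sum_(n < N) v n a.

Lemma outflow_sum N (f : nat -> action D -> R) s :
  outflow (fun a => \sum_(n < N) f n a) s = \sum_(n < N) outflow (f n) s.
Proof. by rewrite exchange_big/=; apply: eq_bigr => a _; rewrite mulr_suml. Qed.

Lemma le_outflow (f g : action D -> R) s : s \notin T ->
  (forall a, src a \notin T -> f a <= g a) -> outflow f s <= outflow g s.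
Proof.
move=> sT fg; apply: ler_sum => a _; have [aT|aT] := boolP (src a \in T).
  rewrite absorbing_trans; last exact: T_absorbing.
  by case: eqP aT sT => [-> ->//|_ _ _]; rewrite !mulr0.
by rewrite ler_wpM2r ?distr_ge0 ?fg.
Qed.

(** Induction on [N]: by balance, uncommitted arrivals at a state are at most [occ y s + z s]; the
    part of this bound that does not commit is exactly [occ y s], and it is split among the actions
    like [y]. *)
Lemma running_le N a : src a \notin T -> V N a <= y a.
Proof.
elim: N a => [|N IH] a aT; first by rewrite /V big_ord0.
set s := src a.
have -> : V N.+1 a = (outflow (V N) s + (s == init_state D)%:R) *
    (1 - switch_prob s) * play_prob a.
  rewrite /V big_ord_recl/= v0 outflow_sum -/s.
  under eq_bigr do rewrite vS -mulrA.
  by rewrite -mulr_suml -/s; ring.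
have h : outflow (V N) s + (s == init_state D)%:R <= occ y s + z s.
  have := balance s; rewrite (negbTE aT) addr0 => <-.
  by rewrite lerD2r; exact: le_outflow.
apply: (@le_trans _ _ ((occ y s + z s) * (1 - switch_prob s) * play_prob a)).
  by rewrite -!mulrA ler_wpM2r// mulr_ge0 ?play_prob_ge0// subr_ge0 switch_prob_le1.
by rewrite mulrBr mulr1 [_ * switch_prob s]mulrC switch_probE addrK play_probE.
Qed.

(** Commitment happens only in [C], as [z] vanishes elsewhere, and the actions [stay] never lead out
    of [C]. *)
Lemma staying_supp n a : w n a != 0 -> a = stay (src a) /\ src a \in C.
Proof.
have stE m b : w m b != 0 -> b = stay (src b).
  move=> wb; apply/eqP; apply: contraNT wb => /negbTE st.
  by case: m => [|m]; rewrite ?w0 ?wS /stay_prob st mulr0.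
move=> wa; split; first exact: stE wa.
apply: contraNT wa.
elim: n a => [|n IH] a aC; first by rewrite w0 switch_probC// mulr0 mul0r.
rewrite wS switch_probC// mulr0 add0r [outflow _ _]big1 ?mul0r// => b _.
have [->|wb] := eqVneq (w n b) 0; first by rewrite mul0r.
have bC : src b \in C by apply: contraNT wb; exact: IH.
have [->|tb] := eqVneq (trans b (src a)) 0; first by rewrite mulr0.
by move: aC; rewrite (stayC bC)// -(stE _ _ wb).
Qed.

(** Commitment is permanent, so the committed mass is the sum over states of [switch_prob] times the
    expected uncommitted arrivals up to time [N]. On [C] these are at most [occ y s + z s]; off [C]
    nothing commits. *)
Lemma staying_mass N : \sum_a w N a <= \sum_s z s.
Proof.
have -> : \sum_a w N a = \sum_s switch_prob s *
    (outflow (V N) s + (s == init_state D)%:R).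
  elim: N => [|N IH].
    rewrite -sum_occ; apply: eq_bigr => s _.
    transitivity ((s == init_state D)%:R * switch_prob s * occ stay_prob s).
      by rewrite /occ mulr_sumr; apply: eq_bigr => a /eqP as_; rewrite w0 as_.
    rewrite occ_stay_prob [outflow _ _]big1; last first.
      by move=> a _; rewrite /V big_ord0 mul0r.
    ring.
  have -> : \sum_a w N.+1 a =
      \sum_s (outflow (v N) s * switch_prob s + outflow (w N) s).
    rewrite -sum_occ; apply: eq_bigr => s _; rewrite -[RHS]mulr1 -(occ_stay_prob s).
    by rewrite /occ mulr_sumr; apply: eq_bigr => a /eqP as_; rewrite wS as_.
  rewrite big_split/= sum_outflow IH -big_split/=; apply: eq_bigr => s _.
  by rewrite /V !outflow_sum big_ord_recr/=; ring.
apply: ler_sum => s _; rewrite -[leRHS]switch_probE.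
have [sC|sC] := boolP (s \in C); last by rewrite switch_probC// !mul0r.
rewrite ler_wpM2l ?switch_prob_ge0//.
have := balance s; rewrite (negbTE (CT sC)) addr0 => <-.
by rewrite lerD2r; apply: le_outflow (CT sC) _ => a; exact: running_le.
Qed.

Let u n a := v n a + w n a.
Hypothesis uflow : action_flow u.

(** By telescoping, the mass in [s] comes from earlier actions outside [T]: uncommitted ones are
    bounded by [y], and committed ones are confined to [C] and cannot enter [s]. *)
Lemma two_modes_target_le N s : s \in T -> occ (u N) s <= x s.
Proof.
move=> sT.
have yx : outflow y s = x s - (s == init_state D)%:R.
  have := balance s; rewrite sT [occ y s]big1; last first.
    by move=> a /eqP as_; rewrite yT ?as_.
  rewrite (zC (contraL (@CT s) sT)) !add0r => <-; ring.
rewrite -(lerD2r (- (s == init_state D)%:R)) -yx -(flow_telescope uflow).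
apply: ler_sum => a _; have [aT|aT] := boolP (src a \in T).
  by rewrite yT// mul0r absorbing_trans ?subrr ?mulr0//; exact: T_absorbing.
rewrite (_ : (src a == s) = false) ?subr0; last first.
  by apply/negbTE; apply: contraNneq aT => ->.
rewrite big_split/= mulrDl -[leRHS]addr0 lerD//.
  by rewrite ler_wpM2r ?distr_ge0// running_le.
rewrite mulr_suml big1// => n _.
have [->|wa] := eqVneq (w n a) 0; first by rewrite mul0r.
have [as_ aC] := staying_supp wa.
have [->|ta] := eqVneq (trans a s) 0; first by rewrite mulr0.
suff /CT : s \in C by rewrite sT.
by apply: (stayC aC); rewrite -as_.
Qed.

(** Upper bounds on the parts of a total mass 1 that themselves add up to 1 must be attained in the
    limit, once the undecided mass [q n] vanishes. *)
Lemma two_modes_target_cvg s : s \in T -> occ (u n) s @[n --> \oo] --> x s.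
Proof.
move=> sT.
(* The mass still uncommitted outside [T]; its sum over time is bounded by the total of [y]. *)
pose q n : R := \sum_(a | src a \notin T) v n a.
have q0 : q n @[n --> \oo] --> 0.
  apply: (@bounded_series_cvg0 _ _ (\sum_a y a)) => [n|N]; first exact: sumr_ge0.
  rewrite exchange_big/= [leRHS](bigID (fun a => src a \notin T))/=.
  rewrite -[leLHS]addr0 lerD ?sumr_ge0//.
  by apply: ler_sum => a; exact: running_le.
(* Summed over all states, the balance equations lose [y] and leave the initial mass 1. *)
have total : \sum_(s in T) x s + \sum_s z s = 1.
  have : \sum_s (outflow y s + (s == init_state D)%:R) =
      \sum_s (occ y s + z s + (if s \in T then x s else 0)).
    by apply: eq_bigr => s' _; exact: balance.
  rewrite !big_split/= sum_outflow sum_occ -big_mkcond/= -addrA => /addrI.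
  suff -> : \sum_s (s == init_state D)%:R = 1 :> R by move=> ->; rewrite addrC.
  by rewrite (bigD1 (init_state D))//= eqxx big1 ?addr0// => s' /negbTE->.
(* The mass 1 splits into targets, [q n] and committed mass. The latter is at most the sum of [z]
   and no other target exceeds its [x], so [q n] covers the deficit at [s]. *)
have gap n : x s - occ (u n) s <= q n.
  have := flow_mass uflow n; rewrite -total (bigID (fun s => s \in T))/= => e.
  have -> : x s - occ (u n) s =
      \sum_(s in T) (x s - occ (u n) s) -
      \sum_(s' in T | s' != s) (x s' - occ (u n) s').
    by rewrite (bigD1 s)//= addrK.
  have le2 : 0 <= \sum_(s' in T | s' != s) (x s' - occ (u n) s').
    by apply: sumr_ge0 => s' /andP[s'T _]; rewrite subr_ge0 two_modes_target_le.
  have e2 : \sum_(s' | s' \notin T) occ (u n) s' = q n + \sum_(a | src a \notin T) w n a.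
    rewrite /q -big_split/= [RHS](partition_big (@src R D) (fun s => s \notin T))//=.
    apply: eq_bigr => s' s'T; apply: eq_bigl => a.
    by case: eqP => [->|_]; rewrite ?s'T ?andbF.
  have e3 : \sum_(a | src a \notin T) w n a <= \sum_s z s.
    apply: le_trans (staying_mass n).
    by rewrite [leRHS](bigID (fun a => src a \notin T))/= lerDl sumr_ge0.
  have eA : \sum_(s' in T) (x s' - occ (u n) s') =
    \sum_(s' in T) x s' - \sum_(s' in T) occ (u n) s' by rewrite sumrB.
  lra.
apply: (@squeeze_cvgr _ _ _ _ (fun n => x s - q n) (fun=> x s)).
- by apply: nearW => n; rewrite two_modes_target_le// andbT lerBlDr addrC -lerBlDr gap.
- by rewrite -[X in _ --> X]subr0; apply: cvgB => //; exact: cvg_cst.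
- exact: cvg_cst.
Qed.

End TwoModes.

(** * The Markov property of runs *)

(** Finite subsums give one inequality for every nonnegative factor; the reverse one is the same
    inequality for [c^-1]. *)
Lemma esumZl (R : realType) (I : choiceType) (A : set I) (c : R)
    (f : I -> \bar R) : 0 <= c -> (forall i, A i -> (0 <= f i)%E) ->
  (\esum_(i in A) (c%:E * f i) = c%:E * \esum_(i in A) f i)%E.
Proof.
move=> c0 f0.
have le k (g : I -> \bar R) : 0 <= k -> (forall i, A i -> (0 <= g i)%E) ->
    (\esum_(i in A) (k%:E * g i) <= k%:E * \esum_(i in A) g i)%E.
  move=> k0 g0; apply: ge_ereal_sup => _ [X [finX XA] <-].
  rewrite !fsbig_finite//= big_seq -ge0_sume_distrr; last first.
    by move=> i; rewrite in_fset_set// inE => /XA/g0.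
  rewrite lee_wpmul2l ?lee_fin// -big_seq -fsbig_finite//.
  by apply: esum_ge; exists X.
apply/eqP; rewrite eq_le le//=.
have [->|cn0] := eqVneq c 0.
  by rewrite mul0e; apply: esum_ge0 => *; rewrite mul0e.
have cK (e : \bar R) : (c^-1%:E * (c%:E * e) = e)%E.
  by rewrite muleA -EFinM mulVf// mul1e.
have := @le c^-1 (fun i => c%:E * f i)%E; rewrite invr_ge0 => /(_ c0).
under eq_esum do rewrite cK.
move=> H; rewrite -[leRHS]mul1e -(divff cn0) EFinM -muleA.
by rewrite lee_wpmul2l ?lee_fin// H// => i Ai; rewrite mule_ge0 ?lee_fin ?f0.
Qed.

Lemma prob_fibers d (T : measurableType d) (R : realType)
    (mu : probability T R) (U : countType) (f : T -> U) (E : set T) :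
  (forall u, measurable (E `&` f @^-1` [set u])) ->
  mu E = \esum_(u in [set: U]) mu (E `&` f @^-1` [set u]).
Proof.
move=> mE; pose F k := E `&` [set w | pickle (f w) = k].
have FE u : F (pickle u) = E `&` f @^-1` [set u].
  apply/seteqP; split=> w [Ew /= h]; split => //=; last by rewrite h.
  exact: (pcan_inj pickleK).
have -> : E = \bigcup_(k in pickle @` [set: U]) F k.
  apply/seteqP; split=> [w Ew|w [k _ []//]].
  by exists (pickle (f w)) => //; exists (f w).
rewrite measure_bigcup => [|_ [u _ <-]|]; last 2 first.
- by rewrite FE.
- by move=> i j _ _ [w [[_ <-] [_ <-]]].
rewrite nneseries_esum => [|n _]; last exact: measure_ge0.
rewrite set_mem_set esum_image; last by move=> u u' _ _ /(pcan_inj pickleK).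
apply: eq_esum => u _; rewrite FE; congr (mu _).
apply/seteqP; split=> w [Ew h]; split => //.
  by exists (pickle (f w)) => //; exists (f w).
by case: Ew => k _ [].
Qed.

Lemma esum_distr (R : realType) (T : choiceType) (p : distr R T) (c : R) :
  0 <= c -> (\esum_(x in [set: T]) (c * p x)%:E = c%:E)%E.
Proof.
move=> c0; under eq_esum do rewrite EFinM.
rewrite esumZl//; last by move=> i _; rewrite lee_fin distr_ge0.
by rewrite distr_sum1 mule1.
Qed.

Section Marginals.
Variables (R : realType) (D : mdp R) (M : countType) (sigma : strategy D M).
Local Notation cfg := (config D M).

Lemma esum_config (s : state D) (c : R) (p : distr R M)
    (p' : M -> distr R (action D)) : 0 <= c ->
  (\esum_(y in [set y : cfg | y.1.1 = s])
     (c * p y.1.2 * p' y.1.2 y.2)%:E = c%:E)%E.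
Proof.
move=> c0.
have -> : [set y : cfg | y.1.1 = s] =
    (fun ma : M * action D => (s, ma.1, ma.2)) @` [set: M * action D].
  apply/seteqP; split=> [[[s' m] a]/= ->|y [ma _ <-//]]; by exists (m, a).
rewrite esum_image; last by move=> [m a] [m' a'] _ _ /= [-> ->].
rewrite -[RHS](esum_distr p c0).
have -> : [set: M * action D] = [set: M] `*`` (fun=> [set: action D]).
  by apply/seteqP; split.
rewrite -(@esum_esum _ _ _ _ _ (fun m a => (c * p m * p' m a)%:E)); last first.
  by move=> m a _ _; rewrite lee_fin !mulr_ge0 ?distr_ge0.
by apply: eq_esum => m _; rewrite esum_distr// mulr_ge0 ?distr_ge0.
Qed.

Lemma step_prob_ge0 (x y : cfg) : 0 <= step_prob sigma x y.
Proof. by case: x y => [[s m] a] [[s' m'] a']; rewrite !mulr_ge0 ?distr_ge0. Qed.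

Lemma init_prob_ge0 (x : cfg) : 0 <= init_prob sigma x.
Proof. by case: x => [[s m] a]; rewrite !mulr_ge0 ?distr_ge0 ?ler0n. Qed.

Lemma path_prob_ge0 (x : cfg) t : 0 <= path_prob sigma x t.
Proof. by elim: t x => //= y t IH x; rewrite mulr_ge0 ?step_prob_ge0. Qed.

Lemma path_prob_rcons (x y : cfg) t :
  path_prob sigma x (rcons t y) = path_prob sigma x t * step_prob sigma (last x t) y.
Proof. by elim: t x => [|z t IH] x /=; rewrite ?mul1r ?mulr1// IH mulrA. Qed.

Lemma esum_step_state (x : cfg) (s : state D) :
  (\esum_(y in [set y : cfg | y.1.1 = s]) (step_prob sigma x y)%:E =
   (trans x.2 s)%:E)%E.
Proof.
rewrite -(esum_config s (update sigma x.2 s x.1.2) (next_move sigma s)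
  (distr_ge0 (trans x.2) s)).
by case: x => [[s0 m] a]; apply: eq_esum => -[[s' m'] a'] /= ->.
Qed.

Lemma esum_init_state (s : state D) :
  (\esum_(y in [set y : cfg | y.1.1 = s]) (init_prob sigma y)%:E =
   ((s == init_state D)%:R)%:E)%E.
Proof.
rewrite -(esum_config s (init_mem sigma) (next_move sigma s) (ler0n _ _)).
by apply: eq_esum => -[[s' m'] a'] /= ->.
Qed.

Variables (P : probability (runs sigma) R) (HP : run_measure P).
Implicit Types (w : runs sigma) (G H : set cfg).

Lemma measurable_at n H : measurable [set w : runs sigma | H (w n)].
Proof.
apply: (@measurable_finite_horizon R D M sigma n.+1) => w w' ww'.
by rewrite /= ww'.
Qed.

Lemma prob_start G :
  P [set w | G (w 0%N)] = \esum_(y in G) (init_prob sigma y)%:E.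
Proof.
rewrite (@prob_fibers _ _ _ P _ (fun w => w 0%N)) => [|u]; last first.
  by apply: measurableI; apply: measurable_at.
rewrite [RHS]esum_mkcond; apply: eq_esum => y _; case: ifPn => yG.
  rewrite -[init_prob _ _]mulr1 -[in RHS](HP y [::]); congr (P _).
  apply/seteqP; split=> w; rewrite /cylinder/=.
    by move=> [_ wy]; rewrite /mkseq/= wy.
  by rewrite /mkseq/= => -[wy]; split; rewrite /= wy//; exact: set_mem.
rewrite (_ : _ `&` _ = set0) ?measure0//; apply/seteqP; split=> // w /= [Gw wy].
by move: Gw; rewrite wy => /mem_set; rewrite (negbTE yG).
Qed.

(* The conditional law of the next configuration depends on the past only
   through the current configuration, so summing over all prefixes ending in H
   factors out the constant c. *)
Lemma prob_step n H G (c : R) : 0 <= c ->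
  (forall x, H x -> \esum_(y in G) (step_prob sigma x y)%:E = c%:E) ->
  P [set w | H (w n) /\ G (w n.+1)] = (c%:E * P [set w | H (w n)])%E.
Proof.
move=> c0 Hc.
have mpre t : measurable [set w : runs sigma | mkseq w n.+1 = t].
  apply: (@measurable_finite_horizon R D M sigma n.+1) => w w' ww' /= <-.
  by apply/eq_in_map => i; rewrite mem_iota add0n => /andP[_ /ww'].
have mHG : measurable [set w : runs sigma | H (w n) /\ G (w n.+1)].
  by apply: measurableI; exact: measurable_at.
rewrite (@prob_fibers _ _ _ P _ (fun w => mkseq w n.+1)) => [|t]; last first.
  exact: (measurableI _ _ mHG (mpre t)).
rewrite [in RHS](@prob_fibers _ _ _ P _ (fun w => mkseq w n.+1)) => [|t]; last first.
  exact: (measurableI _ _ (measurable_at n H) (mpre t)).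
rewrite -esumZl//; apply: eq_esum => t _.
have P0 (Q : set (runs sigma)) : (forall w, ~ Q w) -> P Q = 0%E.
  by move=> Q0; rewrite (_ : Q = set0) ?measure0//; apply/seteqP; split=> // w /Q0.
case: t => [|x t]; first by rewrite !P0 ?mule0// => w [].
have [st|st] := eqVneq (size t) n; last first.
  rewrite !P0 ?mule0// => w [_ /= /(congr1 size)];
    by rewrite size_mkseq => -[e]; rewrite /= e eqxx in st.
have lastE w : mkseq w n.+1 = x :: t -> w n = last x t.
  by move=> e; rewrite -(nth_mkseq x w (ltnSn n)) e -st nth_last.
have [Hx|Hx] := pselect (H (last x t)); last first.
  rewrite !P0 ?mule0// => w [Hw /= /lastE e]; apply: Hx; rewrite -e//.
  by case: Hw.
have -> : [set w : runs sigma | H (w n)] `&` (fun w => mkseq w n.+1) @^-1` [set x :: t] =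
    cylinder (x :: t).
  rewrite /cylinder/= st; apply/seteqP; split=> [w []//|w e]; split => //=.
  by rewrite (lastE _ e).
have -> : [set w : runs sigma | H (w n) /\ G (w n.+1)] `&`
    (fun w => mkseq w n.+1) @^-1` [set x :: t] =
    cylinder (x :: t) `&` [set w | G (w n.+1)].
  rewrite /cylinder/= st; apply/seteqP; split=> [w [[]//]|w [e Gw]]; split => //=.
  by rewrite (lastE _ e).
rewrite (@prob_fibers _ _ _ P _ (fun w => w n.+1)) => [|y]; last first.
  apply: measurableI; last exact: measurable_at.
  by apply: measurableI; [rewrite /cylinder/= st|exact: measurable_at].
(* Reading [c] as a sum of step probabilities from [last x t] matches it, term by term, with the
   cylinders that extend the prefix by one configuration. *)
rewrite HP muleC -(Hc _ Hx) -esumZl; last 2 first.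
- by rewrite mulr_ge0 ?init_prob_ge0 ?path_prob_ge0.
- by move=> y _; rewrite lee_fin step_prob_ge0.
rewrite [RHS]esum_mkcond; apply: eq_esum => y _; case: ifPn => yG.
  rewrite -EFinM -mulrA -path_prob_rcons -HP; congr (P _).
  have mkS w : mkseq w n.+2 = rcons (mkseq w n.+1) (w n.+1).
    by rewrite /mkseq -addn1 iotaD map_cat cats1 add0n.
  rewrite /cylinder/= size_rcons st; apply/seteqP; split=> [w [[e Gw] wy]|w].
    by rewrite /= mkS e wy.
  move=> e; have := mkS w; rewrite [LHS]e -rcons_cons => /rcons_inj h.
  have /= e1 := congr1 fst h; have /= e2 := congr1 snd h.
  by split; [split; [rewrite e1|rewrite /= -e2; exact: set_mem]|].
rewrite (_ : _ `&` _ = set0) ?measure0//; apply/seteqP; split=> // w /= [[_ Gw] wy].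
by move: Gw; rewrite wy => /mem_set; rewrite (negbTE yG).
Qed.

End Marginals.

(** * The law of the reward *)

Section RewardLaw.
Variables (R : realType) (D : mdp R) (M : countType) (sigma : strategy D M).
Variables (P : probability (runs sigma) R) (HP : run_measure P).
Variable T : {set state D}.
Hypothesis T_absorbing : forall s, s \in T -> absorbing s.
Local Notation cfg := (config D M).
Implicit Types (w : runs sigma) (E : set (runs sigma)).

Lemma probE E : measurable E -> P E = (fine (P E))%:E.
Proof. by move=> mE; rewrite fineK// fin_num_measure. Qed.

Lemma measurable_fiber_at (U : Type) n (f : cfg -> U) (u : U) :
  measurable [set w : runs sigma | f (w n) = u].
Proof. exact: (measurable_at n (fun y => f y = u)). Qed.

Lemma prob_partition (U : finType) (f : runs sigma -> U) E :
  (forall u, measurable (E `&` f @^-1` [set u])) ->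
  fine (P E) = \sum_u fine (P (E `&` f @^-1` [set u])).
Proof.
move=> mE; rewrite (@prob_fibers _ _ _ P _ f E)//.
under eq_esum => u _ do rewrite probE//.
rewrite esum_finType// => u; apply: fine_ge0; exact: measure_ge0.
Qed.

Lemma prob_disabled n (x : cfg) : src x.2 != x.1.1 ->
  P [set w | w n = x] = 0%E.
Proof.
move=> ax; have xd : x.2 \notin enabled x.1.1 by rewrite enabled_src.
case: n => [|n].
  rewrite (prob_start HP [set x]) esum_set1 ?lee_fin ?init_prob_ge0//.
  by case: x xd {ax} => [[s m] a] /= xd; rewrite next_enabled ?mulr0.
have := @prob_step _ _ _ _ _ HP n setT [set x] 0 (lexx _).
rewrite mul0e => <- => [|y _].
  by congr (P _); apply/seteqP; split=> [w|w []//]; split.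
rewrite esum_set1 ?lee_fin ?step_prob_ge0//.
by case: x xd {ax} y => [[s m] a] /= xd [[s' m'] a'] /=; rewrite next_enabled ?mulr0.
Qed.

(** Every sequence of configurations is a run, even one that plays disabled actions or leaves a
    target. Regularity excludes this and holds almost surely. *)
Definition regular n w : Prop := src (w n).2 = (w n).1.1 /\
  ((w n).1.1 \in T -> (w n.+1).1.1 = (w n).1.1).

Definition regular_run : set (runs sigma) := [set w | forall n, regular n w].

Lemma measurable_irregular n : measurable [set w : runs sigma | ~ regular n w].
Proof.
apply: (@measurable_finite_horizon R D M sigma n.+2) => w w' ww'.
by rewrite /regular/= !ww'.
Qed.

(** There are countably many pairs of a configuration and a next state; an irregular pair either
    plays a disabled action or leaves an absorbing state by a transition of probability 0. *)
Lemma prob_irregular n : P [set w | ~ regular n w] = 0%E.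
Proof.
pose f w := (w n, (w n.+1).1.1).
have mf u : measurable (f @^-1` [set u]).
  apply: (@measurable_finite_horizon R D M sigma n.+2) => w w' ww'.
  by rewrite /f/= !ww'.
rewrite (@prob_fibers _ _ _ P _ f) => [|u]; last first.
  by apply: measurableI; [exact: measurable_irregular|exact: mf].
apply: esum1 => -[x s] _.
have [reg|irreg] := pselect (src x.2 = x.1.1 /\ (x.1.1 \in T -> s = x.1.1)).
  rewrite (_ : _ `&` _ = set0) ?measure0//; apply/seteqP; split=> // w [nr] /=.
  by rewrite /f => -[wx ws]; apply: nr; rewrite /regular wx ws.
have -> : [set w | ~ regular n w] `&` f @^-1` [set (x, s)] =
    [set w | [set x] (w n) /\ [set y : cfg | y.1.1 = s] (w n.+1)].
  apply/seteqP; split=> w; rewrite /f /regular /=; first by move=> [_ [-> ->]].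
  by move=> [-> ->]; split.
rewrite (@prob_step _ _ _ _ _ HP _ _ _ (trans x.2 s)) ?distr_ge0//; last first.
  by move=> _ ->; exact: esum_step_state.
have [xs|xs] := eqVneq (src x.2) x.1.1; last by rewrite prob_disabled ?mule0.
have xT : x.1.1 \in T by apply: contrapT => xT; apply: irreg.
rewrite absorbing_trans; last by rewrite xs; exact: T_absorbing.
by case: eqP => [e|]; [exfalso; apply: irreg; split => // _; rewrite -e xs|rewrite mul0e].
Qed.

Lemma measurable_regular_run : measurable regular_run.
Proof.
rewrite (_ : regular_run = \bigcap_n ~` [set w | ~ regular n w]).
  apply: bigcapT_measurable => n; apply: measurableC; exact: measurable_irregular.
apply/seteqP; split=> [w rw n _ nr|w rw n]; first exact: nr (rw n).
by apply: contrapT; exact: rw.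
Qed.

Lemma prob_regular E : measurable E -> P (E `&` regular_run) = P E.
Proof.
move=> mE; rewrite [RHS](measureDI P mE measurable_regular_run).
rewrite [X in (X + _)%E](_ : _ = 0%E) ?add0e//.
apply/negligibleP; first exact: measurableD mE measurable_regular_run.
apply: (@negligibleS _ _ _ _ (\bigcup_n [set w | ~ regular n w])).
  by move=> w [_ /existsNP[n]]; exists n.
apply: negligible_bigcup => n; apply/negligibleP; last exact: prob_irregular.
exact: measurable_irregular.
Qed.

Lemma eq_prob_regular E E' : measurable E -> measurable E' ->
  (forall w, regular_run w -> E w <-> E' w) -> P E = P E'.
Proof.
move=> mE mE' EE'; rewrite -prob_regular// -[RHS]prob_regular//; congr (P _).
by apply/seteqP; split=> w [/[swap] rw /(EE' w rw)].
Qed.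

Definition act_prob n a : R := fine (P [set w | (w n).2 = a]).

Lemma occ_act_prob n s : occ (act_prob n) s = fine (P [set w | (w n).1.1 = s]).
Proof.
rewrite (@eq_prob_regular _ [set w | src (w n).2 = s]); last 3 first.
- exact: (measurable_fiber_at n (fun y : cfg => y.1.1)).
- exact: (measurable_fiber_at n (fun y : cfg => src y.2)).
- by move=> w /(_ n)[/= ->].
rewrite (@prob_partition _ (fun w => (w n).2)) => [|a]; last first.
  apply: measurableI; first exact: (measurable_fiber_at n (fun y : cfg => src y.2)).
  exact: (measurable_fiber_at n (fun y : cfg => y.2)).
rewrite /occ big_mkcond/=; apply: eq_bigr => a _; case: eqP => as_.
  congr (fine (P _)); apply/seteqP; split=> [w /= wa|w []//].
  by rewrite wa.
rewrite (_ : _ `&` _ = set0) ?measure0//; apply/seteqP; split=> // w /= [ws wa].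
by apply: as_; rewrite -wa.
Qed.

(** The law of the next state depends on the past only through the action played, so [prob_step]
    applies to the set of all configurations with that action, whatever their memory. *)
Lemma act_prob_flow : action_flow act_prob.
Proof.
split=> [n a|s|n s]; first by apply: fine_ge0; exact: measure_ge0.
  rewrite occ_act_prob (prob_start HP [set y : cfg | y.1.1 = s]).
  by rewrite esum_init_state.
rewrite occ_act_prob (@prob_partition _ (fun w => (w n).2)) => [|a]; last first.
  apply: measurableI; first exact: (measurable_fiber_at n.+1 (fun y : cfg => y.1.1)).
  exact: (measurable_fiber_at n (fun y : cfg => y.2)).
apply: eq_bigr => a _; rewrite mulrC.
rewrite (_ : _ `&` _ =
    [set w | [set y : cfg | y.2 = a] (w n) /\ [set y : cfg | y.1.1 = s] (w n.+1)]).
  rewrite (@prob_step _ _ _ _ _ HP _ _ _ (trans a s)) ?distr_ge0//; last first.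
    by move=> y /= <-; exact: esum_step_state.
  by rewrite fineM// fin_num_measure//; exact: (measurable_fiber_at n (fun y : cfg => y.2)).
by apply/seteqP; split=> w [].
Qed.

Variables (r : state D -> rat) (x : state D -> R).
Hypothesis x_lim :
  forall s, s \in T -> occ (act_prob n) s @[n --> \oo] --> x s.
Local Notation X := (@reward R D M sigma T r).

Definition reached : set (runs sigma) := \bigcup_n [set w | (w n).1.1 \in T].

Lemma measurable_reached : measurable reached.
Proof.
apply: bigcupT_measurable => n; exact: (measurable_at n (fun y => y.1.1 \in T)).
Qed.

(** On regular runs a target is never left, so the reward can be read off at any time spent in [T].
    The events [A n] then increase to the event in question, and continuity from below applies. *)
Lemma prob_reached_reward (Y : set R) : measurable Y ->
  P (reached `&` X @^-1` Y) =
  (\sum_(s in T | ratr (r s) \in Y) x s)%:E.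
Proof.
move=> mY.
pose A n := [set w : runs sigma | (w n).1.1 \in T /\ Y (ratr (r (w n).1.1))].
have mA n : measurable (A n).
  exact: (measurable_at n (fun y : cfg => y.1.1 \in T /\ Y (ratr (r y.1.1)))).
have mX : measurable (reached `&` X @^-1` Y).
  apply: measurableI; first exact: measurable_reached.
  by rewrite -[_ @^-1` _]setTI; exact: measurable_reward.
have stays w : regular_run w -> forall n k, (w n).1.1 \in T ->
    (w (n + k)%N).1.1 = (w n).1.1.
  move=> rw n; elim=> [|k IH] wT; first by rewrite addn0.
  by rewrite addnS (rw (n + k)%N).2 ?IH.
have XE w n : regular_run w -> (w n).1.1 \in T -> X w = ratr (r (w n).1.1).
  move=> rw wT; rewrite /reward; case: pselect => [hit|[]]; last by exists n.
  case: ex_minnP => k kT kmin; have kn := kmin _ wT.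
  by rewrite -(subnKC kn) stays.
have PA n : P (A n) = (\sum_(s in T | ratr (r s) \in Y) occ (act_prob n) s)%:E.
  rewrite probE// (@prob_partition _ (fun w => (w n).1.1)) => [|s]; last first.
    by apply: measurableI => //; exact: (measurable_fiber_at n (fun y : cfg => y.1.1)).
  rewrite [in RHS]big_mkcond; congr (_ %:E); apply: eq_bigr => s _.
  case: ifPn => [/andP[sT /set_mem sY]|nsY].
    rewrite occ_act_prob; congr (fine (P _)).
    by apply/seteqP; split=> [w [//]|w /= ws]; rewrite /A /= ws.
  rewrite (_ : _ `&` _ = set0) ?measure0//; apply/seteqP; split=> // w /= [[wT wY] ws].
  by move: nsY; rewrite -ws wT mem_set.
rewrite -prob_regular//.
have cvgP : P (A n) @[n --> \oo] --> P (reached `&` X @^-1` Y `&` regular_run).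
  rewrite (_ : _ `&` regular_run = \bigcup_n (A n `&` regular_run)); last first.
    apply/seteqP; split=> [w [[[n _ /= wT] wY] rw]|w [n _ [[wT wY] rw]]].
      by exists n => //; split => //; split => //; rewrite -(XE w n).
    by split => //; split; [exists n|rewrite /= (XE w n)].
  under eq_fun do rewrite -prob_regular//.
  apply: nondecreasing_cvg_mu.
  - by move=> n; apply: measurableI => //; exact: measurable_regular_run.
  - apply: bigcupT_measurable => n.
    by apply: measurableI => //; exact: measurable_regular_run.
  - apply/nondecreasing_seqP => n; apply/subsetPset => w [[wT wY] rw]; split=> //.
    by rewrite /A/= (rw n).2.
apply: cvg_unique cvgP _ => //.
rewrite (_ : (fun n => _) =
  (fun n => (\sum_(s in T | ratr (r s) \in Y) occ (act_prob n) s)%:E)); last first.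
  by apply/funext => n; exact: PA.
apply: cvg_EFin; first exact: nearW.
by apply: cvg_big => [|s /andP[sT _]]; [exact: add_continuous|exact: x_lim].
Qed.

Lemma distribution_reward (Y : set R) : measurable Y ->
  distribution P X Y = (\sum_(s in T | ratr (r s) \in Y) x s +
    (if 0 \in Y then 1 - \sum_(s in T) x s else 0))%:E.
Proof.
move=> mY; rewrite /distribution /pushforward.
have mX : measurable (X @^-1` Y).
  by rewrite -[_ @^-1` _]setTI; exact: measurable_reward.
rewrite (measureDI P mX measurable_reached) addeC EFinD setIC.
congr (_ + _)%E; first exact: prob_reached_reward.
have X0 w : ~ reached w -> X w = 0.
  by move=> nr; rewrite /reward; case: pselect => // -[n wT]; case: nr; exists n.
case: ifPn => Y0.
  rewrite (_ : _ `\` _ = ~` reached).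
    rewrite -[LHS]/(P (~` reached)) probability_setC; last exact: measurable_reached.
    (* The whole line as [Y] turns [prob_reached_reward] into the probability of reaching [T]. *)
    rewrite -[reached]setIT -(preimage_setT X) prob_reached_reward//.
    by under eq_bigl do rewrite in_setT andbT.
  apply/seteqP; split=> [w []//|w nr]; split => //=.
  by rewrite X0//; exact: set_mem.
rewrite (_ : _ `\` _ = set0) ?measure0//; apply/seteqP; split=> // w [/= wY nr].
by move: Y0; rewrite -(X0 _ nr) mem_set.
Qed.

End RewardLaw.

(** * Existence of the run measure *)

(* A point of [0, 1[ encodes a path of a finite chain: it lies in exactly one
   of the consecutive intervals of lengths p y, which selects y; blowing this
   interval up to [0, 1[ gives the point that encodes the rest of the path. *)
Section Sampling.
Variables (R : realType) (F : finType).
Implicit Types (p : F -> R) (u : R) (y : F).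

Definition stochastic p := (forall y, 0 <= p y) /\ \sum_y p y = 1.

Definition cumul p n : R := \sum_(z <- take n (enum F)) p z.

Lemma cumulS p y : cumul p (index y (enum F)).+1 = cumul p (index y (enum F)) + p y.
Proof.
rewrite /cumul (take_nth y); last by rewrite index_mem mem_enum.
by rewrite -cats1 big_cat big_seq1 nth_index ?mem_enum.
Qed.

Lemma le_cumul p m n : (forall y, 0 <= p y) -> (m <= n)%N -> cumul p m <= cumul p n.
Proof.
move=> p0 mn; rewrite /cumul -(subnKC mn) takeD big_cat lerDl.
exact: sumr_ge0.
Qed.

Lemma cumul_le1 p n : stochastic p -> cumul p n <= 1.
Proof.
move=> [p0 p1]; have : \sum_(z <- enum F) p z = 1 by rewrite big_enum.
by rewrite -{1}(cat_take_drop n (enum F)) big_cat => <-; rewrite lerDl sumr_ge0.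
Qed.

Definition in_slot p u y :=
  cumul p (index y (enum F)) <= u < cumul p (index y (enum F)) + p y.

Lemma in_slot_uniq p u y y' : (forall y, 0 <= p y) ->
  in_slot p u y -> in_slot p u y' -> y = y'.
Proof.
move=> p0; rewrite /in_slot -!cumulS => /andP[yu uy] /andP[y'u uy'].
have aux i j : cumul p i <= u -> u < cumul p j.+1 -> (i <= j)%N.
  move=> iu uj; rewrite leqNgt; apply/negP => /(le_cumul p0) ji.
  by have := lt_le_trans uj (le_trans ji iu); rewrite ltxx.
have : index y (enum F) = index y' (enum F) by apply/eqP; rewrite eqn_leq !aux.
by move/(congr1 (nth y (enum F))); rewrite !nth_index ?mem_enum.
Qed.

Lemma in_slot_exists p u : stochastic p -> 0 <= u < 1 -> exists y, in_slot p u y.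
Proof.
move=> [p0 p1] /andP[u0 u1].
have ex : exists n, u < cumul p n.
  by exists (size (enum F)); rewrite /cumul take_size big_enum p1.
case: (ex_minnP ex) => -[|n] un nmin.
  by move: un; rewrite /cumul take0 big_nil ltNge u0.
have nF : (n < size (enum F))%N.
  rewrite ltnNge; apply/negP => Fn.
  have : u < cumul p n by move: un; rewrite /cumul !take_oversize// leqW.
  by move/nmin; rewrite ltnn.
have [y0 _] : exists y0 : F, True.
  by case: (enum F) nF => [//|y0 s _]; exists y0.
exists (nth y0 (enum F) n); rewrite /in_slot -cumulS index_uniq ?enum_uniq// un andbT.
by rewrite leNgt; apply/negP => /nmin; rewrite ltnn.
Qed.

Variables (y0 : F) (k : F -> F -> R).
Hypothesis kP : forall y, stochastic (k y).

Definition select p u : F := odflt y0 [pick y | in_slot p u y].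

Definition blowup p u y : R := (u - cumul p (index y (enum F))) / p y.

Fixpoint sample_path p u n : F :=
  let y := select p u in
  if n is n'.+1 then sample_path (k y) (blowup p u y) n' else y.

Lemma selectE p u y : stochastic p -> 0 <= u < 1 ->
  (select p u = y) <-> in_slot p u y.
Proof.
move=> pP u01; rewrite /select; case: pickP => [y' y'u|h] /=; last first.
  by have [y' y'u] := in_slot_exists pP u01; rewrite h in y'u.
by split=> [<-//|yu]; apply: in_slot_uniq y'u yu; case: pP.
Qed.

Lemma sample_path_mkseq p u n : mkseq (sample_path p u) n.+1 =
  select p u :: mkseq (sample_path (k (select p u)) (blowup p u (select p u))) n.
Proof.
by rewrite /mkseq/= -[1%N]addn0 iotaDl -map_comp.
Qed.

Fixpoint weight p (t : seq F) : R :=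
  if t is y :: t' then p y * weight (k y) t' else 1.

(** Induction on [t]: the points whose path begins with [y :: t] are the preimage under the affine
    map [blowup] of the interval found for [t], so its length is multiplied by [p y]. *)
Lemma sample_path_interval p t : stochastic p -> exists a,
  [/\ 0 <= a, 0 <= weight p t, a + weight p t <= 1 &
      forall u, 0 <= u < 1 ->
        (mkseq (sample_path p u) (size t) = t <-> a <= u < a + weight p t)].
Proof.
elim: t p => [|y t IH] p pP.
  by exists 0; rewrite add0r; split=> // u ->.
have [a [a0 w0 aw1 h]] := IH (k y) (kP y).
have [p0 p1] := pP.
have c0 : 0 <= cumul p (index y (enum F)) by exact: sumr_ge0.
exists (cumul p (index y (enum F)) + p y * a); split => /=.
- by rewrite addr_ge0 ?mulr_ge0.
- by rewrite mulr_ge0.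
- rewrite -addrA -mulrDr; apply: le_trans (cumul_le1 (index y (enum F)).+1 pP).
  by rewrite cumulS lerD2l ler_piMr.
move=> u u01; rewrite sample_path_mkseq.
(* An empty slot is selected by no point; it is treated apart because [blowup] divides by [p y]. *)
have [py0|py] := eqVneq (p y) 0.
  rewrite py0 !mul0r !addr0; split=> [[/(selectE _ pP u01)]|/andP[a1 a2]].
    by rewrite /in_slot py0 addr0 => /andP[a1 a2]; have := le_lt_trans a1 a2; rewrite ltxx.
  by have := le_lt_trans a1 a2; rewrite ltxx.
have pgt : 0 < p y by rewrite lt_neqAle eq_sym py p0.
have sE : in_slot p u y = (0 <= blowup p u y < 1).
  by rewrite /in_slot /blowup pmulr_lge0 ?invr_gt0// subr_ge0 ltr_pdivrMr// mul1r ltrBlDl.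
have -> : (cumul p (index y (enum F)) + p y * a <= u <
    cumul p (index y (enum F)) + p y * a + p y * weight (k y) t) =
    (a <= blowup p u y < a + weight (k y) t).
  rewrite /blowup ler_pdivlMr// ltr_pdivrMr// lerBrDl ltrBlDl.
  by rewrite [a * _]mulrC [(_ + _) * p y]mulrC mulrDr addrA.
split=> [[sy]|hu].
  have := sy; rewrite selectE// sE => ub; by rewrite sy => /(h _ ub).
have ub : 0 <= blowup p u y < 1.
  case/andP: hu => h1 h2; rewrite (le_trans a0 h1)/=.
  exact: lt_le_trans h2 aw1.
have -> : select p u = y by apply/selectE => //; rewrite sE.
by congr (_ :: _); apply/(h _ ub).
Qed.

End Sampling.

Lemma uniform_prob_itv (R : realType) (a b : R) : 0 <= a -> b <= 1 -> a <= b ->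
  uniform_prob (@ltr01 R) `[a, b[%classic = (b - a)%:E.
Proof.
move=> a0 b1 ab; rewrite /uniform_prob.
rewrite (eq_integral (fun=> 1%:E)); last first.
  move=> x; rewrite inE/= in_itv/= => /andP[ax xb].
  by rewrite /uniform_pdf (le_trans a0 ax) (ltW (lt_le_trans xb b1)) subr0 invr1.
rewrite integral_cst//= lebesgue_measure_itv/= mul1e lte_fin.
by case: ltgtP ab => // -> _; rewrite subrr.
Qed.

Section RunMeasure.
Variables (R : realType) (D : mdp R) (M : finType) (sigma : strategy D M).
Local Notation cfg := (state D * M * action D)%type.

Lemma distr_sum (U : finType) (p : distr R U) : \sum_u p u = 1.
Proof.
by apply: EFin_inj; rewrite -(distr_sum1 p) esum_finType// => u; exact: distr_ge0.
Qed.

Lemma sum_cfg (s : state D -> R) (p : state D -> distr R M)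
    (p' : state D -> M -> distr R (action D)) :
  \sum_(y : cfg) s y.1.1 * p y.1.1 y.1.2 * p' y.1.1 y.1.2 y.2 = \sum_x s x.
Proof.
rewrite -(pair_bigA _ (fun sm a => s sm.1 * p sm.1 sm.2 * p' sm.1 sm.2 a))/=.
under eq_bigr do rewrite -mulr_sumr distr_sum mulr1.
rewrite -(pair_bigA _ (fun x m => s x * p x m))/=.
by apply: eq_bigr => x _; rewrite -mulr_sumr distr_sum mulr1.
Qed.

Lemma init_stochastic : stochastic (init_prob sigma : cfg -> R).
Proof.
split=> [[[s m] a]|]; first by rewrite /= !mulr_ge0 ?distr_ge0 ?ler0n.
transitivity (\sum_(s : state D) (s == init_state D)%:R : R).
  rewrite -(sum_cfg _ (fun=> init_mem sigma) (next_move sigma)).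
  by apply: eq_bigr => -[[s m] a].
by rewrite (bigD1 (init_state D))//= eqxx big1 ?addr0// => s /negbTE->.
Qed.

Lemma step_stochastic (x : cfg) : stochastic (step_prob sigma x : cfg -> R).
Proof.
case: x => -[s0 m0] a0.
split=> [[[s m] a]|]; first by rewrite /= !mulr_ge0 ?distr_ge0 ?ler0n.
rewrite -(distr_sum (trans a0)).
rewrite -(sum_cfg _ (fun s => update sigma a0 s m0) (next_move sigma)).
by apply: eq_bigr => -[[s m] a].
Qed.

Let y0 : cfg := (point : runs sigma) 0%N.
Let path u : runs sigma := sample_path y0 (step_prob sigma) (init_prob sigma) u.

Definition sampled_run (u : measurableTypeR R) : runs sigma :=
  if 0 <= (u : R) < 1 then path u else point.

Lemma sampled_run_cylinder t : exists a, [/\ 0 <= a,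
  0 <= weight (step_prob sigma) (init_prob sigma) t,
  a + weight (step_prob sigma) (init_prob sigma) t <= 1 &
  `[0, 1[%classic `&` sampled_run @^-1` (cylinder t) =
  `[a, a + weight (step_prob sigma) (init_prob sigma) t[%classic].
Proof.
have [a [a0 w0 aw h]] := sample_path_interval y0 step_stochastic t init_stochastic.
exists a; split => //; apply/seteqP; split=> u; rewrite /= !in_itv/= /sampled_run.
  by move=> [u01]; rewrite u01 => /h; exact.
move=> hu; have u01 : 0 <= u < 1.
  case/andP: hu => h1 h2; rewrite (le_trans a0 h1)/=; exact: lt_le_trans h2 aw.
by split=> //; rewrite u01; apply/h.
Qed.

Lemma measurable_sampled_run : measurable_fun [set: measurableTypeR R] sampled_run.
Proof.
have mE : @measurable _ (runs sigma) = <<s range (@cylinder R D M sigma) >> by [].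
apply: (measurability _ mE).
move=> _ [_ [t _ <-] <-]; rewrite setTI.
have [a [_ _ _ h]] := sampled_run_cylinder t.
(* Outside [0, 1[ the map is constant, so a preimage contains all of that complement or none of
   it. *)
have [h0|h0] := pselect (cylinder (sigma := sigma) t point).
  rewrite (_ : _ @^-1` _ = `[a, a + weight (step_prob sigma) (init_prob sigma) t[%classic
      `|` ~` `[0, 1[%classic).
    by apply: measurableU; [|apply: measurableC]; exact: measurable_itv.
  rewrite -h; apply/seteqP; split=> u /=; rewrite in_itv/=.
    by case: (boolP (0 <= u < 1)) => u01 hu; [left|right].
  by move=> [[]//|/negP u01]; rewrite /sampled_run (negbTE u01).
rewrite (_ : _ @^-1` _ = `[a, a + weight (step_prob sigma) (init_prob sigma) t[%classic).
  exact: measurable_itv.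
rewrite -h; apply/seteqP; split=> u /=; rewrite in_itv/=; last by case.
by move=> hu; split=> //; apply: contrapT => /negP u01; apply: h0; move: hu;
  rewrite /sampled_run (negbTE u01).
Qed.

HB.instance Definition _ := isMeasurableFun.Build _ _ _ _ sampled_run
  measurable_sampled_run.

(** The uniform law is pushed forward along [sampled_run]: up to a null set, a cylinder pulls back
    to an interval whose length is the required product of probabilities. *)
Lemma run_measure_exists : exists P : probability (runs sigma) R, run_measure P.
Proof.
exists (distribution (uniform_prob (@ltr01 R)) sampled_run) => x t.
have weightE (y : cfg) s : weight (step_prob sigma) (step_prob sigma y) s =
    path_prob sigma y s.
  by elim: s y => //= z s IH y; rewrite IH.
have -> : init_prob sigma x * path_prob sigma x t =
    weight (step_prob sigma) (init_prob sigma) (x :: t) by rewrite /= weightE.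
have [a [a0 w0 aw h]] := sampled_run_cylinder (x :: t).
pose U : probability (measurableTypeR R) R := uniform_prob (@ltr01 R).
pose I : set (measurableTypeR R) := `[0, 1[%classic.
have mc : measurable (sampled_run @^-1` (cylinder (x :: t))).
  rewrite -[_ @^-1` _]setTI; apply: measurable_sampled_run => //.
  by apply: sub_sigma_algebra; exists (x :: t).
have mI : measurable I by exact: measurable_itv.
transitivity (U (sampled_run @^-1` (cylinder (x :: t)) `\` I) +
              U (sampled_run @^-1` (cylinder (x :: t)) `&` I))%E.
  exact: (measureDI U mc mI).
have -> : U (sampled_run @^-1` (cylinder (x :: t)) `\` I) = 0%E.
  apply/(negligibleP U); first exact: measurableD.
  apply: (@negligibleS _ _ _ _ (~` I)); first by move=> u [].
  apply/(negligibleP U); first exact: measurableC.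
  rewrite -[LHS]/(U _) probability_setC// -[U I]/(uniform_prob (@ltr01 R) I).
  by rewrite uniform_prob_itv// subr0 subee.
rewrite add0e setIC h -[LHS]/(uniform_prob (@ltr01 R) _) uniform_prob_itv//.
  by rewrite addrAC subrr add0r.
by rewrite lerDl.
Qed.

End RunMeasure.

(** * The two-memory strategy *)

Section SameLaw.
Context {d d' : measure_display} {U : measurableType d} {U' : measurableType d'}.
Context {R : realType}.
Variables (P : probability U R) (P' : probability U' R).
Variables (X : {RV P >-> R}) (X' : {RV P' >-> R}).
Hypothesis law : forall Y : set R, measurable Y ->
  distribution P X Y = distribution P' X' Y.

(** The change of variables is applied to positive and negative parts separately, where it needs no
    integrability. *)
Lemma expectation_law : ('E_P[X] = 'E_P'[X'])%E.
Proof.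
rewrite !expectation_def integralE [RHS]integralE.
have posE : (\int[P]_w (EFin \o X)^\+ w = \int[P']_w (EFin \o X')^\+ w)%E.
  have mf := measurable_funepos (@EFin_measurable R setT).
  rewrite (funepos_comp _ X) (funepos_comp _ X') -[LHS](ge0_integral_distribution X mf)//.
  rewrite -[RHS](ge0_integral_distribution X' mf)//.
  by apply: eq_measure_integral => Y mY _; exact: law.
have negE : (\int[P]_w (EFin \o X)^\- w = \int[P']_w (EFin \o X')^\- w)%E.
  have mf := measurable_funeneg (@EFin_measurable R setT).
  rewrite (funeneg_comp _ X) (funeneg_comp _ X') -[LHS](ge0_integral_distribution X mf)//.
  rewrite -[RHS](ge0_integral_distribution X' mf)//.
  by apply: eq_measure_integral => Y mY _; exact: law.
by congr (_ - _)%E; [exact: posE|exact: negE].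
Qed.

Lemma VaR_law p : VaR X p = VaR X' p.
Proof.
congr sup; apply/seteqP; split=> a /=; rewrite /cdf law//.
Qed.

Lemma CVaR_law p : CVaR X p = CVaR X' p.
Proof.
rewrite /CVaR VaR_law law//; congr (_ * (_ + _))%E.
by apply: eq_measure_integral => Y mY _; exact: law.
Qed.

End SameLaw.

Section FiniteDistr.
Variables (R : realType) (U : finType) (f : U -> R).
Hypothesis f_ge0 : forall u, 0 <= f u.
Hypothesis f_sum1 : \sum_u f u = 1.

Lemma finite_distr_sum1 : (\esum_(u in [set: U]) (f u)%:E = 1)%E.
Proof. by rewrite esum_finType// f_sum1. Qed.

Definition finite_distr : distr R U := Distr f_ge0 finite_distr_sum1.

End FiniteDistr.

Section ConfigMarginals.
Variables (R : realType) (D : mdp R) (M : finType) (sigma : strategy D M).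
Variables (P : probability (runs sigma) R) (HP : run_measure P).
Variable T : {set state D}.
Hypothesis T_absorbing : forall s, s \in T -> absorbing s.
Local Notation cfg := (config D M).

(** Fixing the state to [src a] loses no mass, since configurations with a disabled action have
    probability 0; memory and action suffice as indices. *)
Definition conf_prob n (m : M) (a : action D) : R :=
  fine (P [set w | w n = (src a, m, a)]).

Lemma conf_prob_ge0 n m a : 0 <= conf_prob n m a.
Proof. by apply: fine_ge0; exact: measure_ge0. Qed.

Lemma conf_probE n m a :
  conf_prob n m a = fine (P [set w | ((w n).1.2, (w n).2) = (m, a)]).
Proof.
congr fine; apply: (eq_prob_regular HP T_absorbing).
- exact: (measurable_at n (fun y : cfg => y = (src a, m, a))).
- exact: (measurable_at n (fun y : cfg => (y.1.2, y.2) = (m, a))).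
move=> w /(_ n)[/= wr _]; split=> [->//|].
by case: (w n) wr => -[s m'] a' /= <- [-> ->].
Qed.

Lemma act_prob_conf n a : act_prob P n a = \sum_m conf_prob n m a.
Proof.
rewrite /act_prob (@prob_partition _ _ _ _ _ _ (fun w => (w n).1.2)) => [|m].
  apply: eq_bigr => m _; rewrite conf_probE; congr (fine (P _)).
  by apply/seteqP; split=> w /=; [move=> [-> ->]|move=> [-> ->]].
by apply: measurableI;
  [exact: (measurable_at n (fun y : cfg => y.2 = a))|
   exact: (measurable_at n (fun y : cfg => y.1.2 = m))].
Qed.

Lemma conf_prob0 m a : conf_prob 0 m a =
  (src a == init_state D)%:R * init_mem sigma m * next_move sigma (src a) m a.
Proof.
rewrite /conf_prob (prob_start HP [set (src a, m, a)]) esum_set1//.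
by rewrite lee_fin (init_prob_ge0 sigma (src a, m, a)).
Qed.

Lemma conf_probS n m a : conf_prob n.+1 m a =
  \sum_m' \sum_b conf_prob n m' b *
    (trans b (src a) * update sigma b (src a) m' m * next_move sigma (src a) m a).
Proof.
rewrite pair_bigA {1}/conf_prob.
rewrite (@prob_partition _ _ _ _ _ _ (fun w => ((w n).1.2, (w n).2))) => [|mb].
  apply: eq_bigr => -[m' b] _; rewrite conf_probE mulrC.
  rewrite (_ : _ `&` _ =
    [set w | [set y : cfg | (y.1.2, y.2) = (m', b)] (w n) /\
             [set (src a, m, a)] (w n.+1)]); last by apply/seteqP; split=> w [].
  rewrite (@prob_step _ _ _ _ _ HP _ _ _ (trans b (src a) *
    update sigma b (src a) m' m * next_move sigma (src a) m a)).
  - rewrite fineM// fin_num_measure//.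
    exact: (measurable_at n (fun y : cfg => (y.1.2, y.2) = (m', b))).
  - by rewrite !mulr_ge0 ?distr_ge0.
  - case=> -[s m0] b0 /= [-> ->]; rewrite esum_set1//.
    by rewrite lee_fin !mulr_ge0 ?distr_ge0.
by apply: measurableI;
  [exact: (measurable_at n.+1 (fun y : cfg => y = (src a, m, a)))|
   exact: (measurable_at n (fun y : cfg => (y.1.2, y.2) = mb))].
Qed.

End ConfigMarginals.

(* The memory element true means that the flow y is still being followed, and
   false that the play has been committed to stay in C forever. *)
Section TwoMemoryStrategy.
Variables (R : realType) (D : mdp R).
Variables (stay : state D -> action D) (y : action D -> R) (z : state D -> R).
Hypothesis src_stay : forall s, src (stay s) = s.
Hypothesis y_ge0 : forall a, 0 <= y a.
Hypothesis z_ge0 : forall s, 0 <= z s.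

Let mode (p : R) (b : bool) : R := if b then 1 - p else p.

Lemma mode_ge0 s b : 0 <= mode (switch_prob y z s) b.
Proof.
by case: b; rewrite /mode ?subr_ge0 ?switch_prob_le1 ?switch_prob_ge0.
Qed.

Lemma mode_sum1 p : \sum_b mode p b = 1.
Proof. by rewrite big_bool /mode/= subrK. Qed.

Definition mode_distr s : distr R bool :=
  finite_distr (mode_ge0 s) (mode_sum1 _).

Lemma committed_sum1 : \sum_b (~~ b)%:R = 1 :> R.
Proof. by rewrite big_bool/= add0r. Qed.

Definition committed : distr R bool :=
  finite_distr (fun b => ler0n R (~~ b)) committed_sum1.

Let move (s : state D) (b : bool) (a : action D) : R :=
  (src a == s)%:R * (if b then play_prob stay y a else stay_prob stay a).

Lemma move_ge0 s b a : 0 <= move s b a.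
Proof. by case: b; rewrite mulr_ge0 ?play_prob_ge0 ?stay_prob_ge0 ?ler0n. Qed.

Lemma move_sum1 s b : \sum_a move s b a = 1.
Proof.
transitivity (occ (if b then play_prob stay y else stay_prob stay) s).
  rewrite /occ [RHS]big_mkcond; apply: eq_bigr => a _; rewrite /move.
  by case: eqP; case: b; rewrite ?mul1r ?mul0r.
by case: b; [exact: occ_play_prob|exact: occ_stay_prob].
Qed.

Definition move_distr s b : distr R (action D) :=
  finite_distr (move_ge0 s b) (move_sum1 s b).

Lemma move_enabled s b a : a \notin enabled s -> move_distr s b a = 0.
Proof. by rewrite enabled_src /= /move => /negbTE->; rewrite mul0r. Qed.

(** The update is given the state just entered, so the choice to commit is made on arrival; the
    initial memory makes the same choice for the initial state. *)
Definition two_memory : strategy D bool :=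
  @Strategy R D bool (fun _ s b => if b then mode_distr s else committed)
    move_distr move_enabled (mode_distr (init_state D)).

End TwoMemoryStrategy.

Theorem theorem5p5 (R : realType) (D : mdp R) (T : {set state D})
    (T_absorbing : forall s, s \in T -> absorbing s)
    (r : state D -> rat) (q : query R) :
  (exists (M : countType) (sigma : strategy D M), satisfies sigma T r q) ->
  exists M : finType, #|M| = 2%N /\
    exists sigma : strategy D M, satisfies sigma T r q.
Proof.
move=> [M [sigma [P HP [e_ok c_ok v_ok]]]].
have flowP := act_prob_flow HP T_absorbing.
(* On targets these limits exist, because the mass there is nondecreasing and at most 1. *)
pose x s := limn (fun n => occ (act_prob P n) s).
have x_lim s : s \in T -> occ (act_prob P n) s @[n --> \oo] --> x s.
  by move=> sT; exact: (flow_target_cvg T_absorbing flowP sT).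
have [C [y [z [[y0 z0] CT stayC [zC yT] bal]]]] :=
  stationary_flow T_absorbing flowP x_lim.
have [stay stayP] : exists stay : state D -> action D, forall s,
    src (stay s) = s /\
    (s \in C -> forall s', trans (stay s) s' != 0 -> s' \in C).
  suff : forall s, exists a, src a = s /\
      (s \in C -> forall s', trans a s' != 0 -> s' \in C).
    by move=> /boolp.choice[stay h]; exists stay.
  move=> s; have [sC|sC] := boolP (s \in C).
    by have [a as_ h] := stayC s sC; exists a.
  have /set0Pn[a] := enabled_neq0 s; rewrite enabled_src => /eqP as_.
  by exists a.
have src_stay s : src (stay s) = s := (stayP s).1.
pose tau := two_memory src_stay y0 z0.
have [P' HP'] := run_measure_exists tau.
have flowP' := act_prob_flow HP' T_absorbing.
have x_lim' s : s \in T -> occ (act_prob P' n) s @[n --> \oo] --> x s.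
  move=> sT.
  have uE n a : act_prob P' n a = conf_prob P' n true a + conf_prob P' n false a.
    by rewrite (act_prob_conf HP' T_absorbing) big_bool.
  have cS := conf_probS HP' T_absorbing.
  have c0 := conf_prob0 HP'.
  rewrite (_ : (fun n => occ _ s) = fun n => occ
    (fun a => conf_prob P' n true a + conf_prob P' n false a) s); last first.
    by apply/funext => n; apply: eq_bigr => a _; exact: uE.
  apply: (two_modes_target_cvg T_absorbing CT src_stay _ y0 z0 zC yT bal) => //.
  - by move=> s'; exact: (stayP s').2.
  - by move=> n a; exact: conf_prob_ge0.
  - by move=> n a; exact: conf_prob_ge0.
  - by move=> a; rewrite c0 /= eqxx mul1r; case: eqP => [->|_]; rewrite ?mul0r.
  - move=> n a; rewrite cS big_bool/= eqxx mul1r.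
    (* Commitment is irrevocable: memory [false] never returns to [true]. *)
    rewrite [X in _ + X]big1 ?addr0; last by move=> b _; rewrite mulr0 mul0r mulr0.
    rewrite /outflow !mulr_suml; apply: eq_bigr => b _; ring.
  - by move=> a; rewrite c0 /= eqxx mul1r; case: eqP => [->|_]; rewrite ?mul0r.
  - move=> n a; rewrite cS big_bool/= eqxx mul1r mulrDl /outflow.
    by rewrite !mulr_suml; congr (_ + _); apply: eq_bigr => b _; ring.
  - have -> : (fun n a => conf_prob P' n true a + conf_prob P' n false a) =
        act_prob P' by apply/funext => n; apply/funext => a; rewrite uE.
    exact: flowP'.
exists bool; split; first by rewrite card_bool.
exists tau, P' => //=.
pose X : {RV P >-> R} := @reward R D M sigma T r.
pose X' : {RV P' >-> R} := @reward R D bool tau T r.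
have law Y : measurable Y -> distribution P X Y = distribution P' X' Y.
  (* Both laws are the same function of the common limits [x]. *)
  move=> mY; rewrite (distribution_reward HP T_absorbing r x_lim mY).
  by rewrite (distribution_reward HP' T_absorbing r x_lim' mY).
split.
- by have h := expectation_law law; rewrite -h.
- by have h := CVaR_law law (cvar_level q); rewrite -h.
- by have h := VaR_law law (var_level q); rewrite -h.
Qed.
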